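(* Let $d\geq 4$ with $d\equiv 0\bmod 4$. Assume the following (conjectural) statement for $d$: for any choice of signs of the $\mathsf{w}_\pi$ and for every $(d-1)$-partition $\pi$ there is $\omega_\pi\in\mathbb{Q}$ such that, for all $\ell\in\mathbb{Z}$, the specialization below is well-defined and $$L_\pi(\ell)\,\mathsf{w}_\pi\Big|_{\lambda_1+\cdots+\lambda_{d-1}=\lambda_d=0}=(-1)^{|\pi|}\,\omega_\pi\prod_{i=1}^{\pi_{1\ldots1}}(\ell-(i-1)),$$ and moreover there is a choice of signs of all $\mathsf{w}_\pi$ such that, for all $\ell\in\mathbb{Z}$, $$1+\sum_{\pi,\ |\pi|\geq 1}L_\pi(\ell)\,\mathsf{w}_\pi\Big|_{\lambda_1+\cdots+\lambda_{d-1}=\lambda_d=0}\,q^{|\pi|}=M_{d-2}(-q)^{\ell}.$$ Then, for the numbers $\omega_\pi$ corresponding to such a choice of signs, $$\sum_{(d-1)\text{-partitions }\pi}\omega_\pi\,t^{\pi_{1\ldots1}}\,q^{|\pi|}=e^{t(M_{d-2}(q)-1)},$$ where $t$ is a formal variable. In particular, setting $t=1$, $$\sum_{(d-1)\text{-partitions }\pi}\omega_\pi\,q^{|\pi|}=e^{M_{d-2}(q)-1}.$$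
   Context: An $n$-partition is a family $\pi=\{\pi_{i_1\ldots i_n}\}_{i_1,\ldots,i_n\geq 1}$ of non-negative integers with $\pi_{i_1\ldots i_n}\geq\pi_{j_1\ldots j_n}$ whenever $i_a\leq j_a$ for all $a$, and with finite size $|\pi|:=\sum\pi_{i_1\ldots i_n}$. Put $M_n(q):=\sum_{n\text{-partitions }\pi}q^{|\pi|}$. For the empty partition, $\omega_\emptyset:=1$. $(\mathbb{C}^* )^d$ acts on $\mathbb{C}^d$ in the standard way, the coordinate function $x_i$ having character $t_i$; $\lambda_i$ is the equivariant first Chern class of $t_i$. $T=\{t_1\cdots t_d=1\}\subset(\mathbb{C}^* )^d$ is the Calabi-Yau subtorus, so $\lambda_1+\cdots+\lambda_d=0$ on $T$. The $T$-fixed points of $\mathrm{Hilb}^n(\mathbb{C}^d)$ are the subschemes $Z_\pi$ for $(d-1)$-partitions $\pi$ of size $n$, with ideal $I_{Z_\pi}=\langle x_1^{i_1-1}\cdots x_{d-1}^{i_{d-1}-1}x_d^{\pi_{i_1\ldots i_{d-1}}}\rangle_{i_1,\ldots,i_{d-1}\geq 1}$. $\mathrm{Ext}^i(I_Z,I_Z)_0$ is the trace-free part of $\mathrm{Ext}^i(I_Z,I_Z)$; $\mathrm{Ext}^{\mathrm{even}}(\cdot)_0$, $\mathrm{Ext}^{\mathrm{odd}}(\cdot)_0$ are the sums over even, resp. odd, degrees in $K_T(\mathrm{pt})$. For a virtual representation $\sum_w a_wt^w$ the Euler class is $\prod_w(\sum_j w_j\lambda_j)^{a_w}$ ($0$ if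 the trivial character has positive coefficient; defined only if this coefficient is non-negative); quotients of Euler classes mean the Euler class of the virtual difference. Standing assumption in the definition: $\mathrm{Ext}^{\mathrm{even}}(I_Z,I_Z)_0-\mathrm{Ext}^{\mathrm{odd}}(I_Z,I_Z)_0\in K_T(\mathrm{pt})$ has non-negative coefficient at the trivial $T$-character for every $T$-fixed $Z$. Define, up to sign, $$\mathsf{w}_\pi:=\pm\sqrt{(-1)^{|\pi|}\frac{e_T(\mathrm{Ext}^{\mathrm{even}}(I_{Z_\pi},I_{Z_\pi})_0)}{e_T(\mathrm{Ext}^{\mathrm{odd}}(I_{Z_\pi},I_{Z_\pi})_0)}}$$ in the fraction field of $\mathbb{Q}[\lambda_1,\ldots,\lambda_d]/(\lambda_1+\cdots+\lambda_d)$ (the radicand is a square there). For $\ell\in\mathbb{Z}$ put $L_\pi(\ell):=e_T(H^0(\mathcal{O}_{Z_\pi})\otimes t_d^{-\ell})$. The specialization $\lambda_1+\cdots+\lambda_{d-1}=\lambda_d=0$ means restricting the rational function on $\{\lambda_1+\cdots+\lambda_d=0\}$ to its hyperplane $\lambda_d=0$. *)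

(* Defs.v *)
From HB Require Import structures.
From mathcomp Require Import all_boot all_order all_algebra.
From mathcomp Require Import boolp classical_sets functions cardinality fsbigop.
From mathcomp Require Import Rstruct.
From mathcomp Require Import complex mpoly.

Set Implicit Arguments.
Unset Strict Implicit.
Unset Printing Implicit Defensive.

Import Order.TTheory GRing.Theory Num.Theory.
Local Open Scope classical_set_scope.
Local Open Scope ring_scope.

(** The dimension [d >= 2] is written [d = m.+2] throughout,
    so that [(d-1)]-partitions are [npart m.+1] and [M_(d-2)] is [Mser m].
    Infinite sums and products over a classical set are those of [fsbigop],
    i.e. they range over the finite support of the summand. *)

(** * Formal power series in q, as sequences of coefficients *)

Definition fps (A : Type) := nat -> A.

Section PowerSeries.
Variable A : comUnitRingType.

Definition fps_one : fps A := fun N => (N == 0)%:R.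
Definition fps_add (f g : fps A) : fps A := fun N => f N + g N.
Definition fps_sub (f g : fps A) : fps A := fun N => f N - g N.
Definition fps_scale (a : A) (f : fps A) : fps A := fun N => a * f N.
Definition fps_mul (f g : fps A) : fps A :=
  fun N => \sum_(k < N.+1) f k * g (N - k)%N.
Definition fps_exp (f : fps A) (k : nat) : fps A := iter k (fps_mul f) fps_one.

(** The series f(-q). *)
Definition fps_negq (f : fps A) : fps A := fun N => (-1) ^+ N * f N.

(** 1 / f = \sum_k (1 - f)^k, for [f] with constant coefficient 1; the terms
    with [k > N] do not contribute to the coefficient of q^N. *)
Definition fps_inv (f : fps A) : fps A :=
  fun N => \sum_(k < N.+1) fps_exp (fps_sub fps_one f) k N.

Definition fps_expz (f : fps A) (l : int) : fps A :=
  match l with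
  | Posz k => fps_exp f k
  | Negz k => fps_exp (fps_inv f) k.+1
  end.

(** e^f = \sum_k f^k / k!, for [f] with constant coefficient 0 (and [A] a
    Q-algebra); same remark on the terms with [k > N]. *)
Definition fps_expe (f : fps A) : fps A :=
  fun N => \sum_(k < N.+1) (k`!%:R)^-1 * fps_exp f k N.

End PowerSeries.

(** * n-partitions.  Indices are shifted to start at 0. *)

Record npart (n : nat) := NPart {
  part :> {ffun 'I_n -> nat} -> nat;
  part_anti : forall i j : {ffun 'I_n -> nat},
    (forall a, (i a <= j a)%N) -> (part j <= part i)%N;
  part_fin : finite_set [set i | part i != 0%N]
}.

HB.instance Definition _ n := gen_eqMixin (npart n).
HB.instance Definition _ n := gen_choiceMixin (npart n).

Definition psize n (pi : npart n) : nat :=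
  \big[addn/0%N]_(i \in [set: {ffun 'I_n -> nat}]) pi i.

(** The entry pi_(1...1). *)
Definition corner n (pi : npart n) : nat := pi [ffun=> 0%N].

(** \sum_(pi | P pi) F(pi) q^|pi| *)
Definition pseries (A : comUnitRingType) n (P : set (npart n))
    (F : npart n -> A) : fps A :=
  fun N => \sum_(pi \in [set pi | psize pi = N /\ P pi]) F pi.

Definition Mser (A : comUnitRingType) (n : nat) : fps A :=
  pseries [set: npart n] (fun=> 1).

(** * Characters of (C^* )^d, monomials and monomial ideals.
    The weight [w] is the character t^w; it is also the weight of x^w. *)

Definition wt (d : nat) := {ffun 'I_d -> int}.

Definition lew d (u v : wt d) : bool := [forall j, u j <= v j].

(** Exponent of x_1^(i_1-1)...x_(d-1)^(i_(d-1)-1) x_d^(pi_(i_1...i_(d-1))). *)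
Definition ideal_gen m (pi : npart m.+1) (i : {ffun 'I_m.+1 -> nat}) :
    wt m.+2 :=
  [ffun j => if unlift ord_max j is Some a then (i a)%:Z else (pi i)%:Z].

(** x^v \in I_(Z_pi) *)
Definition in_ideal m (pi : npart m.+1) (v : wt m.+2) : bool :=
  `[< exists i, lew (ideal_gen pi i) v >].

(** * Z^d-graded free resolutions of monomial ideals.
    Let S = K[x_1,...,x_d]; S_v is K x^v if v >= 0 and is 0 otherwise.  A
    homogeneous map of degree 0 from S(-a) to S(-b) is c x^(a-b) for a scalar
    c, with c = 0 unless b <= a.  Hence a map of finite Z^d-graded free modules
    is the same as a scalar matrix satisfying this condition, here acting on row
    vectors, and likewise for a map to the ideal I.  The piece of degree v of
    such a module consists of the scalar vectors supported on the generators of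
    degree <= v. *)

Definition in_degree (K : fieldType) d r (dg : 'I_r -> wt d) (v : wt d)
    (u : 'rV[K]_r) : Prop := forall j, u 0 j != 0 -> lew (dg j) v.

(** ... -> F_2 -> F_1 -> F_0 -> I -> 0, with F_i = \bigoplus_j S(-res_deg i j). *)
Record free_resolution (K : fieldType) d (I : pred (wt d)) := FreeResolution {
  res_rank : nat -> nat;
  res_deg : forall i, 'I_(res_rank i) -> wt d;
  res_diff : forall i, 'M[K]_(res_rank i.+1, res_rank i);
  res_aug : 'cV[K]_(res_rank 0);
  res_diff_homog : forall i j k,
    res_diff i j k != 0 -> lew (res_deg k) (res_deg j);
  res_aug_homog : forall j, res_aug j 0 != 0 -> I (res_deg j);
  res_aug_complex : res_diff 0 *m res_aug = 0;
  res_diff_complex : forall i, res_diff i.+1 *m res_diff i = 0;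
  res_aug_surj : forall v, I v ->
    exists2 u, in_degree (@res_deg 0) v u & u *m res_aug = 1%:M;
  res_aug_exact : forall v u, in_degree (@res_deg 0) v u -> u *m res_aug = 0 ->
    exists2 u', in_degree (@res_deg 1) v u' & u' *m res_diff 0 = u;
  res_diff_exact : forall i v u,
    in_degree (@res_deg i.+1) v u -> u *m res_diff i = 0 ->
    exists2 u', in_degree (@res_deg i.+2) v u' & u' *m res_diff i.+1 = u
}.

(** Every finitely generated monomial ideal has such a resolution: take
    F_i free on the (i+1)-tuples of generators, each placed in the degree of its
    lcm, with the simplicial differential. *)

Section TupleResolution.
Variables (K : fieldType) (d : nat) (T : finType) (g : T -> wt d).

Fixpoint bd (s t : seq T) : K :=
  if s is x :: s' then
    (s' == t)%:R - (if t is y :: t' then (x == y)%:R * bd s' t' else 0)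
  else 0.

Fixpoint lcmw (s : seq T) : wt d :=
  if s is x :: s' then [ffun j => Num.max (g x j) (lcmw s' j)] else [ffun=> 0].

Lemma lcmwP s v :
  reflect (lew [ffun=> 0] v /\ forall x, x \in s -> lew (g x) v)
    (lew (lcmw s) v).
Proof.
elim: s => [|x s IHs] /=; first by apply: (iffP idP) => [|[]//].
have -> : lew [ffun j => Num.max (g x j) (lcmw s j)] v
          = lew (g x) v && lew (lcmw s) v.
  apply/forallP/andP => [h|[/forallP h1 /forallP h2] j].
    by split; apply/forallP => j; have := h j; rewrite ffunE ge_max => /andP[].
  by rewrite ffunE ge_max h1 h2.
apply: (iffP andP) => [[hx /IHs[h0 h]]|[h0 h]].
  by split=> // y; rewrite inE => /orP[/eqP->|/h].
split; first by apply: h; rewrite mem_head.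
by apply/IHs; split=> // y ys; apply: h; rewrite inE ys orbT.
Qed.

Lemma lewxx (v : wt d) : lew v v. Proof. exact/forallP. Qed.

Lemma lew_trans (u v w : wt d) : lew u v -> lew v w -> lew u w.
Proof. by move=> /forallP h /forallP k; apply/forallP => j; apply: le_trans (k j). Qed.

Lemma bd_sub s t : bd s t != 0 -> {subset t <= s}.
Proof.
elim: s t => [|x s IHs] t /=; first by rewrite eqxx.
case: (s =P t) => [<- _ z zs|_]; first by rewrite inE zs orbT.
case: t => [|y t]; first by rewrite subr0 eqxx.
rewrite sub0r oppr_eq0 mulf_eq0 negb_or => /andP[].
case: (x =P y) => [->|]; rewrite ?eqxx// => _ /IHs h z.
by rewrite !inE => /orP[->//|/h->]; rewrite orbT.
Qed.

Lemma sum_tuple n (F : seq T -> K) :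
  \sum_(s : n.+1.-tuple T) F s = \sum_x \sum_(s : n.-tuple T) F (x :: s).
Proof.
rewrite pair_big /=.
rewrite (reindex (fun p : T * n.-tuple T => cons_tuple p.1 p.2)) //=.
exists (fun s => (thead s, behead_tuple s)) => [[x s] _|s _] /=.
  by congr (_, _); apply: val_inj.
by rewrite [RHS]tuple_eta; apply: val_inj.
Qed.

Lemma sum_tuple_eq n (t : n.-tuple T) (F : seq T -> K) :
  \sum_(s : n.-tuple T) F s * ((s : seq T) == t)%:R = F t.
Proof.
rewrite (bigD1 t) //= eqxx mulr1 big1 ?addr0// => s.
by rewrite -val_eqE /= => /negPf->; rewrite mulr0.
Qed.

Lemma sum_tuple_if n x (f h : seq T -> K) :
  \sum_(s : n.+1.-tuple T)
    (if (s : seq T) is y :: s' then (x == y)%:R * f s' else 0) * h s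
  = \sum_(s : n.-tuple T) f s * h (x :: s).
Proof.
rewrite (sum_tuple _ (fun s => (if s is y :: s' then _ else _) * h s)) /=.
rewrite (bigD1 x) //= eqxx [X in _ + X]big1 ?addr0; last first.
  by move=> y /negPf hy; rewrite big1// => s _; rewrite eq_sym hy !mul0r.
by under eq_bigr do rewrite mul1r.
Qed.

Lemma bd_bd n (r : n.+2.-tuple T) (t : n.-tuple T) :
  \sum_(s : n.+1.-tuple T) bd r s * bd s t = 0.
Proof.
have step i (x : T) (u : i.+1.-tuple T) (v : i.-tuple T) :
    \sum_(s : i.+1.-tuple T) bd (x :: u) s * bd s v
    = bd u v - \sum_(s : i.-tuple T) bd u s * bd (x :: s) v.
  rewrite /= -(sum_tuple_if i x (bd u) (bd^~ v)) -[X in X - _](sum_tuple_eq u (bd^~ v)).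
  rewrite -sumrB; apply: eq_bigr => s _.
  by rewrite mulrBl [X in X - _]mulrC [(u : seq T) == s]eq_sym.
elim: n r t => [|n IHn] /tupleP[x r] t; rewrite step /=;
    under eq_bigr do rewrite mulrBr; rewrite sumrB (sum_tuple_eq t (bd r)).
  rewrite tuple0 /= [X in _ - X](_ : _ = bd r [::]) ?subrr//.
  by rewrite [X in _ - X]big1 ?subr0// => s _; rewrite mulr0.
case/tupleP: t => y t /=.
under [X in _ - (_ - X)]eq_bigr do rewrite mulrCA.
by rewrite -mulr_sumr IHn mulr0 subr0 subrr.
Qed.

Let rk i := #|{: i.-tuple T}|.
Let tv i (a : 'I_(rk i)) : i.-tuple T := enum_val a.
Let tr i (s : i.-tuple T) : 'I_(rk i) := enum_rank s.
Let D i : 'M[K]_(rk i.+1, rk i) := \matrix_(a, b) bd (tv a) (tv b).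
Let dg i (a : 'I_(rk i)) : wt d := lcmw (tv a).

Let tvK i (a : 'I_(rk i)) : tr (tv a) = a. Proof. exact: enum_valK. Qed.
Let trK i (s : i.-tuple T) : tv (tr s) = s. Proof. exact: enum_rankK. Qed.

Lemma sum_tv i (F : i.-tuple T -> K) :
  \sum_(a : 'I_(rk i)) F (tv a) = \sum_(s : i.-tuple T) F s.
Proof.
by rewrite [RHS](reindex (@tv i)) //=; exists (@tr i) => x _; rewrite ?tvK ?trK.
Qed.

Lemma D_D i : D i.+1 *m D i = 0.
Proof.
apply/matrixP => a b; rewrite [RHS]mxE -[RHS](bd_bd (tv a) (tv b)) -sum_tv mxE.
by apply: eq_bigr => c _; rewrite !mxE.
Qed.

Lemma D_homotopy i (x : T) (u : 'rV[K]_(rk i.+1)) : u *m D i = 0 ->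
  (\row_(a < rk i.+2) ((x == thead (tv a))%:R * u 0 (tr (behead_tuple (tv a)))))
  *m D i.+1 = u.
Proof.
move=> uD; apply/rowP => b; rewrite mxE.
pose U (s : seq T) : K :=
  if insub s is Some t then u 0 (tr (t : i.+1.-tuple T)) else 0.
have UE (t : i.+1.-tuple T) : U t = u 0 (tr t) by rewrite /U valK.
transitivity (\sum_(s : i.+2.-tuple T)
  (if (s : seq T) is y :: s' then (x == y)%:R * U s' else 0) * bd s (tv b)).
  rewrite -sum_tv; apply: eq_bigr => a _; rewrite !mxE -UE.
  by case/tupleP: (tv a) => y s /=; rewrite theadE.
rewrite (sum_tuple_if _ x U (bd^~ (tv b))) -[RHS](congr1 (u 0) (tvK b)) -UE -[RHS]subr0.
rewrite -[U (tv b)](sum_tuple_eq (tv b) U).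
have uD0 (t : i.-tuple T) : \sum_(s : i.+1.-tuple T) U s * bd s t = 0.
  have := congr1 (fun M : 'rV_ _ => M 0 (tr t)) uD; rewrite !mxE => h; rewrite -[RHS]h {h}.
  rewrite -sum_tv; apply: eq_bigr => a _.
  by rewrite !mxE UE tvK trK.
case/tupleP: (tv b) => y t /=.
under eq_bigr do rewrite mulrBr [X in _ - X]mulrCA.
by rewrite sumrB -mulr_sumr uD0 mulr0.
Qed.

Variable I : pred (wt d).
Hypothesis g_ge0 : forall x j, 0 <= g x j.
Hypothesis IP : forall v, I v <-> exists x, lew (g x) v.

Lemma tuple_resolution : exists F : free_resolution K I, True.
Proof.
pose ag : 'cV[K]_(rk 1) := const_mx 1.
have tv1 (a : 'I_(rk 1)) b : bd (tv a) (tv (b : 'I_(rk 0))) = 1.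
  rewrite (tuple0 (tv b)); case/tupleP: (tv a) => x s.
  by rewrite (tuple0 s) /= subr0.
have Dag n (u : 'M_(n, rk 1)) : u *m ag = 0 <-> u *m D 0 = 0.
  split=> /matrixP h; apply/matrixP => a b.
    have := h a 0; rewrite !mxE => e; rewrite -[RHS]e; apply: eq_bigr => c _.
    by rewrite !mxE tv1.
  have := h a (tr [tuple]); rewrite !mxE => e; rewrite -[RHS]e; apply: eq_bigr => c _.
  by rewrite !mxE tv1.
have ge0 v : I v -> lew [ffun=> 0] v.
  move=> /IP[x /forallP h]; apply/forallP => j; rewrite ffunE.
  exact: le_trans (h j).
have dgI i (a : 'I_(rk i.+1)) v : lew (dg a) v -> I v.
  move=> /lcmwP[_ h]; apply/IP; exists (thead (tv a)); apply: h.
  by case/tupleP: (tv a) => x s; rewrite theadE mem_head.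
have exactD i v (u : 'rV_(rk i.+1)) :
    in_degree (@dg i.+1) v u -> u *m D i = 0 ->
    exists2 u', in_degree (@dg i.+2) v u' & u' *m D i.+1 = u.
  move=> uv uD; have [Iv|nIv] := boolP (I v); last first.
    exists 0; first by move=> j; rewrite mxE eqxx.
    rewrite mul0mx; apply/rowP => j; rewrite mxE; apply/esym/eqP.
    by apply: contraNT nIv => /uv/dgI.
  have [x xv] := (IP v).1 Iv.
  eexists; last exact: (D_homotopy x).
  move=> a; rewrite mxE mulf_eq0 negb_or /dg => /andP[].
  case/tupleP: (tv a) => y s; rewrite theadE.
  case: (x =P y) => [<- _|]; rewrite ?eqxx// => /uv/lcmwP; rewrite trK => -[h0 h].
  by apply/lcmwP; split=> // z; rewrite inE => /orP[/eqP->//|]; exact: h.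
unshelve eexists (@FreeResolution K d I (fun i => rk i.+1) (fun i => @dg i.+1)
  (fun i => D i.+1) ag _ _ _ _ _ _ _) => //.
- move=> i j k; rewrite mxE => /bd_sub h; apply/lcmwP.
  have /lcmwP[h0 h1] := lewxx (dg j); split=> // x /h; exact: h1.
- by move=> j _; apply: dgI (lewxx _).
- by apply/Dag; exact: D_D.
- by move=> i; exact: D_D.
- move=> v Iv; have [x xv] := (IP v).1 Iv.
  exists (delta_mx 0 (tr [tuple x])).
    move=> j; rewrite mxE eqxx /=.
    case: (j =P _) => [->|_]; last by rewrite mulr0n eqxx.
    move=> _.
    apply/lcmwP; split; first exact: ge0.
    by move=> y; rewrite trK inE => /eqP->.
  apply/matrixP => a b; rewrite !ord1 !mxE (bigD1 (tr [tuple x])) //= !mxE !eqxx.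
  by rewrite mulr1 big1 ?addr0// => c /negPf hc; rewrite !mxE hc andbF mul0r.
- by move=> v u uv /Dag; exact: exactD.
- by move=> i v u; exact: exactD.
Qed.

End TupleResolution.

Lemma ideal_resolution_exists (K : fieldType) m (pi : npart m.+1) :
  exists F : free_resolution K (in_ideal pi), True.
Proof.
have [s sE] : exists s : seq {ffun 'I_m.+1 -> nat},
    forall i, pi i != 0%N -> i \in s.
  have /finite_seqP[s sE] := part_fin pi.
  by exists s => i pi0; have : [set` s] i by rewrite -sE.
pose B := (\max_(i <- s) \max_a i a).+1.
have BP (i : {ffun 'I_m.+1 -> nat}) a : (B <= i a)%N -> pi i = 0%N.
  move=> Bi; apply/eqP; apply: contraTT Bi => /sE is_; rewrite -ltnNge ltnS.
  by apply: leq_trans (leq_bigmax a) _; exact: leq_bigmax_seq is_ isT.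
pose T := {ffun 'I_m.+1 -> 'I_B.+1}.
pose emb (x : T) : {ffun 'I_m.+1 -> nat} := [ffun a => x a : nat].
apply: (@tuple_resolution K _ T (fun x => ideal_gen pi (emb x))) => [x j|v].
  by rewrite ffunE; case: unlift.
split=> [/asboolP[i iv]|[x xv]]; last by apply/asboolP; exists (emb x).
pose x : T := [ffun a => inord (minn (i a) B)].
have xE a : emb x a = minn (i a) B by rewrite !ffunE inordK// ltnS geq_minr.
exists x; apply/forallP => j; have /forallP/(_ j) := iv; apply: le_trans.
rewrite !ffunE; case: unliftP => [a _|_].
  by rewrite lez_nat xE geq_minl.
rewrite lez_nat.
have [/existsP[a aB]|/existsPn h] := boolP [exists a, B <= i a]%N.
  by rewrite (BP _ a) // xE leq_min aB leqnn.
suff -> : emb x = i by [].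
by apply/ffunP => a; rewrite xE; apply/minn_idPl; rewrite ltnW// ltnNge h.
Qed.

Definition ideal_resolution (K : fieldType) m (pi : npart m.+1) :
    free_resolution K (in_ideal pi) :=
  projT1 (cid (ideal_resolution_exists K pi)).

(** * Ext groups, as (C^* )^d-representations *)

Section Ext.
Variables (K : fieldType) (d : nat) (I : pred (wt d)).
Variable F : free_resolution K I.

(** In weight w, Hom_S(F_i, I) consists of the scalar column vectors phi,
    sending the j-th generator, of degree a, to phi_j x^(a+w); so phi_j = 0
    unless x^(a+w) \in I. *)
Definition cochain_dim (i : nat) (w : wt d) : nat :=
  #|[set j : 'I_(res_rank F i) | I (res_deg j + w)]|.

(** Rank of Hom_S(F_i, I)_w -> Hom_S(F_(i+1), I)_w, phi |-> res_diff i *m phi. *)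
Definition cobord_rank (i : nat) (w : wt d) : nat :=
  \rank (\matrix_(j, k) (if I (res_deg k + w) then res_diff F i j k else 0)).

(** dim Ext^i_S(I, I)_w = dim ker - dim im at the i-th place of Hom_S(F, I)_w. *)
Definition ext_dim (i : nat) (w : wt d) : int :=
  (cochain_dim i w)%:Z - (cobord_rank i w)%:Z
  - (if i is i'.+1 then (cobord_rank i' w)%:Z else 0).

(** Trace-free part: the kernel of tr : Ext^i(I, I) -> H^i(O_(C^d)).  The trace
    is a split surjection (I has rank 1, so it is split by O -> RHom(I, I)),
    H^0(O_(C^d)) = S, and H^i(O_(C^d)) = 0 for i > 0. *)
Definition ext0_dim (i : nat) (w : wt d) : int :=
  ext_dim i w - ((i == 0%N) && lew 0 w)%:Z.

Definition ext0_even (w : wt d) : int :=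
  \sum_(i \in [set i : nat | ~~ odd i]) ext0_dim i w.
Definition ext0_odd (w : wt d) : int :=
  \sum_(i \in [set i : nat | odd i]) ext0_dim i w.

End Ext.

Definition Cplx : fieldType := complex Rdefinitions.R.

(** * Virtual representations and T-equivariant Euler classes *)

(** [V w] is the coefficient of t^w. *)
Definition vrep (d : nat) := wt d -> int.

(** Ext^even(I_Z, I_Z)_0 - Ext^odd(I_Z, I_Z)_0 *)
Definition ext0_rep m (pi : npart m.+1) : vrep m.+2 :=
  fun w => ext0_even (ideal_resolution Cplx pi) w
           - ext0_odd (ideal_resolution Cplx pi) w.

(** H^0(O_(Z_pi)) tensor t_d^(-l) *)
Definition OZ_twist m (pi : npart m.+1) (l : int) : vrep m.+2 :=
  fun w => let v : wt m.+2 := [ffun j => w j + (if j == ord_max then l else 0)] in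
    (lew 0 v && ~~ in_ideal pi v)%:Z.

(** Two characters of (C^* )^d agree on T iff they differ by a multiple of
    (1,...,1); [Tcoef V w] is the coefficient in V of the T-character of t^w. *)
Definition Tcoef d (V : vrep d) (w : wt d) : int :=
  \sum_(k \in [set: int]) V [ffun j => w j + k].

(** Q[lambda_1,...,lambda_(n+1)]/(lambda_1+...+lambda_(n+1)), presented as the
    polynomial ring in lambda_1,...,lambda_n. *)
Definition lam (n : nat) (j : 'I_n.+1) : {mpoly rat[n]} :=
  if unlift ord_max j is Some i then 'X_i else - \sum_(i < n) 'X_i.

Definition ratfun (n : nat) : fieldType := {fraction {mpoly rat[n]}}.

Definition lin n (w : wt n.+1) : ratfun n := tofrac (\sum_j (w j)%:~R * lam j).

(** The product runs over the T-characters, each represented by the unique w with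
    w_d = 0.  The factor w = 0 is 0 ^ a, hence 0 if a > 0 and 1 if a = 0; the
    definition is meant only for a >= 0. *)
Definition euler n (V : vrep n.+1) : ratfun n :=
  \big[*%R/1]_(w \in [set w : wt n.+1 | w ord_max = 0]) lin w ^ Tcoef V w.

Definition ext0_admissible m : Prop :=
  forall pi : npart m.+1, 0 <= Tcoef (ext0_rep pi) 0.

Definition radicand m (pi : npart m.+1) : ratfun m.+1 :=
  (-1) ^+ psize pi * euler (ext0_rep pi).

(** A choice of square root for each pi, i.e. a choice of all signs. *)
Definition is_w m (w : npart m.+1 -> ratfun m.+1) : Prop :=
  forall pi, w pi ^+ 2 = radicand pi.

Definition Lins m (pi : npart m.+1) (l : int) : ratfun m.+1 :=
  euler (OZ_twist pi l).

(** * Specialization to the hyperplane lambda_d = 0 *)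

(** Q[lambda_1..lambda_d]/(\sum lambda) -> Q[lambda_1..lambda_(d-1)]/(\sum lambda),
    lambda_i |-> lambda_i for i < d, hence lambda_d |-> 0. *)
Definition restr_poly m (p : {mpoly rat[m.+1]}) : {mpoly rat[m]} :=
  p \mPo [tuple lam i | i < m.+1].

(** [f] is defined at the generic point of the hyperplane and restricts to [g]. *)
Definition restricts_to m (f : ratfun m.+1) (g : ratfun m) : Prop :=
  exists p q : {mpoly rat[m.+1]},
    [/\ restr_poly q != 0, f = tofrac p / tofrac q
      & g = tofrac (restr_poly p) / tofrac (restr_poly q)].

(** The restriction of [f]; 0 when not well-defined. *)
Definition restriction m (f : ratfun m.+1) : ratfun m :=
  xget 0 [set g | restricts_to f g].

Definition const m (c : rat) : ratfun m := tofrac c%:MP.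

(** * The conjecture *)

(** For all l, L_pi(l) w_pi has a well-defined specialization, equal to
    (-1)^|pi| omega \prod_i (l - (i - 1)). *)
Definition omega_at m (w : npart m.+1 -> ratfun m.+1) (pi : npart m.+1)
    (omega : rat) : Prop :=
  forall l : int,
    restricts_to (Lins pi l * w pi)
      (const m ((-1) ^+ psize pi * omega
                * \prod_(i < corner pi) (l%:~R - (i : nat)%:R))).

(** 1 + \sum_(|pi| >= 1) L_pi(l) w_pi| q^|pi| = M_(d-2)(-q)^l for all l. *)
Definition good_signs m (w : npart m.+1 -> ratfun m.+1) : Prop :=
  forall l : int,
    (forall pi, (1 <= psize pi)%N ->
       exists g, restricts_to (Lins pi l * w pi) g) /\
    fps_add (fps_one (ratfun m))
      (pseries [set pi | (1 <= psize pi)%N]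
         (fun pi => restriction (Lins pi l * w pi)))
    =1 fps_expz (fps_negq (Mser (ratfun m) m)) l.

Definition conjecture m : Prop :=
  (forall w, is_w w -> forall pi : npart m.+1, exists omega, omega_at w pi omega)
  /\ (exists2 w : npart m.+1 -> ratfun m.+1, is_w w & good_signs w).

(** The numbers omega_pi attached to a choice of signs; omega_emptyset = 1 by
    convention, whatever the sign of w_emptyset. *)
Definition is_omega m (w : npart m.+1 -> ratfun m.+1)
    (omega : npart m.+1 -> rat) : Prop :=
  (forall pi, psize pi = 0%N -> omega pi = 1) /\
  (forall pi, (1 <= psize pi)%N -> omega_at w pi (omega pi)).

(* Main.v *)
Require Import Defs.
From mathcomp Require Import all_boot all_order all_algebra.
From mathcomp Require Import boolp classical_sets cardinality fsbigop.
From mathcomp Require Import mpoly.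

Set Implicit Arguments.
Unset Strict Implicit.
Unset Printing Implicit Defensive.

Import GRing.Theory Num.Theory.
Local Open Scope classical_set_scope.
Local Open Scope ring_scope.

(** The geometry provides two facts: the restriction of L_pi(l) w_pi is
    (-1)^|pi| omega_pi times a falling factorial of l, and the generating series
    of these restrictions is M(-q)^l, where M = M_(d-2).  For l = k a
    natural number, the signs cancel and comparing coefficients of q^N gives,
    with c = pi_(1...1),

      \sum_(|pi| = N) omega_pi k(k-1)...(k-c+1) = [q^N] M(q)^k

    ([omega_ffact_sum]).  Put g = M - 1, which has constant coefficient 0.  By
    the binomial formula the right-hand side is

      \sum_(j <= N) k(k-1)...(k-j+1) [q^N] g^j / j!,

    and the left-hand side has the same shape once the partitions are grouped
    by their corner entry j <= N.  Falling factorials of different lengths are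
    linearly independent as functions of k ([ffact_independent]), so the sum of
    omega_pi over the partitions of size N with corner entry j is
    [q^N] g^j / j! ([corner_sumE]).  Multiplying by t^j and summing over j gives
    the coefficient of q^N in e^(t g).

    There are finitely many partitions of each size ([finite_psize]), so the
    sums over them are not affected by the convention that a sum with infinite
    support is 0. *)

(** * Partitions of given size *)

Lemma npart_ext n (pi rho : npart n) : pi =1 rho -> pi = rho.
Proof.
case: pi rho => [p pa pf] [r ra rf] /= /funext e; subst r.
by congr NPart; apply: Prop_irrelevance.
Qed.

Lemma leq_sum_psize n (pi : npart n) (s : seq {ffun 'I_n -> nat}) :
  uniq s -> (\sum_(i <- s) pi i <= psize pi)%N.
Proof.
move=> us; have /finite_seqP[t tE] := part_fin pi.
pose r := s ++ [seq i <- undup t | i \notin s].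
have ur : uniq r.
  rewrite cat_uniq us filter_uniq ?undup_uniq // andbT.
  by apply/hasPn => i; rewrite mem_filter => /andP[].
rewrite /psize (fsbigE r) //; last first.
  move=> i _; rewrite mem_cat mem_filter mem_undup negb_or negb_and.
  case: (i \in s) => //= it; apply/eqP; apply: contraNT it => pi0.
  by have : [set` t] i by rewrite -tE.
under [leqRHS]eq_bigl do rewrite in_setT.
by rewrite big_cat leq_addr.
Qed.

Lemma leq_psize n (pi : npart n) i : (pi i <= psize pi)%N.
Proof. by have := leq_sum_psize pi (isT : uniq [:: i]); rewrite big_seq1. Qed.

(** The support of a partition contains the segment of points obtained from
    [i] by lowering one coordinate, which has [(i a).+1] elements. *)
Lemma ltn_psize_supp n (pi : npart n) i a : pi i != 0%N -> (i a < psize pi)%N.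
Proof.
move=> pi_i.
pose down k : {ffun 'I_n -> nat} := [ffun b => if b == a then k else i b].
have inj_down : injective down.
  by move=> k l /ffunP/(_ a); rewrite !ffunE eqxx.
have u : uniq (map down (iota 0 (i a).+1)).
  by rewrite map_inj_uniq ?iota_uniq.
apply: leq_trans (leq_sum_psize pi u).
apply: (@leq_trans (\sum_(k <- iota 0 (i a).+1) 1)%N).
  by rewrite sum1_size size_iota.
rewrite big_map big_seq [leqRHS]big_seq.
apply: leq_sum => k; rewrite mem_iota ltnS => /= ki.
apply: leq_trans (_ : pi i <= _)%N; first by rewrite lt0n.
by apply: part_anti => b; rewrite ffunE; case: eqP => // ->.
Qed.

(** A partition of size N has entries at most N and vanishes outside the cube
    of side N, so it is determined by finitely many bounded values.  The code is
    optional so that it is injective exactly on the partitions of size N. *)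
Lemma finite_psize n N : finite_set [set pi : npart n | psize pi = N].
Proof.
pose code (pi : npart n) :
    option {ffun {ffun 'I_n -> 'I_N.+1} -> 'I_N.+1} :=
  if psize pi == N then
    Some [ffun x : {ffun 'I_n -> 'I_N.+1} => inord (pi [ffun a => x a : nat])]
  else None.
have -> : [set pi : npart n | psize pi = N] = code @^-1` [set~ None].
  by apply/seteqP; split=> pi /=; rewrite /code; case: eqP.
apply: finite_preimage finite_finset => pi rho.
rewrite !inE /= /code; case: eqP => // hp _; case: eqP => // hr _.
move=> [/ffunP e]; apply: npart_ext => i.
have [/forallP iN|/forallPn[a aN]] := boolP [forall a, i a <= N]%N.
  pose x : {ffun 'I_n -> 'I_N.+1} := [ffun a => inord (i a)].
  have xE : [ffun a => x a : nat] = i.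
    by apply/ffunP => a; rewrite !ffunE inordK ?ltnS.
  have := congr1 val (e x); rewrite !ffunE xE /=.
  have bound (sigma : npart n) : psize sigma = N -> (sigma i < N.+1)%N.
    by move=> <-; rewrite ltnS leq_psize.
  by rewrite !inordK ?bound.
have zero (sigma : npart n) : psize sigma = N -> sigma i = 0%N.
  move=> hs; apply/eqP; apply: contraNT aN => /(ltn_psize_supp a).
  by rewrite hs => /ltnW.
by rewrite !zero.
Qed.

Definition empty_npart n : npart n.
Proof.
refine (@NPart n (fun=> 0%N) _ _) => //.
by rewrite (_ : [set _ | _] = set0) //; apply/seteqP; split=> i.
Defined.

Lemma psize_eq0 n : [set pi : npart n | psize pi = 0%N] = [set empty_npart n].
Proof.
apply/seteqP; split=> [pi /= h|_ /= ->].
  by apply: npart_ext => i; apply/eqP; rewrite -leqn0 -h leq_psize.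
by rewrite /psize fsbig1.
Qed.

(** * The series over all partitions *)

Lemma pseriesE (A : comUnitRingType) n (F : npart n -> A) N :
  pseries [set: npart n] F N
  = \sum_(pi <- finmap.enum_fset (fset_set [set pi : npart n | psize pi = N])) F pi.
Proof.
rewrite /pseries -fsbig_finite; last exact: finite_psize.
suff -> : [set pi | psize pi = N /\ [set: npart n] pi] = [set pi | psize pi = N].
  by [].
by apply/seteqP; split=> pi //= [].
Qed.

Lemma pseries_rmorph (A B : comUnitRingType) (f : {rmorphism A -> B}) n
    (F : npart n -> A) N :
  pseries [set: npart n] (f \o F) N = f (pseries [set: npart n] F N).
Proof. by rewrite !pseriesE rmorph_sum. Qed.

Lemma Mser_rmorph (A B : comUnitRingType) (f : {rmorphism A -> B}) n :
  Mser B n = f \o Mser A n.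
Proof.
apply/funext => N; rewrite /= /Mser -pseries_rmorph.
by congr (pseries _ _ _); apply/funext => pi /=; rewrite rmorph1.
Qed.

Lemma Mser0 (A : comUnitRingType) n : Mser A n 0 = 1.
Proof.
by rewrite /Mser pseriesE -fsbig_finite ?psize_eq0 ?fsbig_set1 //;
  exact: finite_set1.
Qed.

(** * Powers of power series *)

Lemma fps_exp_rmorph (A B : comUnitRingType) (f : {rmorphism A -> B}) g k N :
  fps_exp (f \o g) k N = f (fps_exp g k N).
Proof.
elim: k N => [|k IHk] N; first by rewrite /= /fps_one rmorph_nat.
rewrite /= /fps_mul rmorph_sum; apply: eq_bigr => i _.
by rewrite rmorphM; congr (_ * _); apply: IHk.
Qed.

Section PowerSeries.
Variable A : comUnitRingType.
Implicit Types f g : fps A.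

Lemma fps_exp_negq f k N : fps_exp (fps_negq f) k N = (-1) ^+ N * fps_exp f k N.
Proof.
elim: k N => [|k IHk] N; first by rewrite /= /fps_one; case: N => [|N]; rewrite ?mulr1 ?mulr0.
rewrite /= /fps_mul big_distrr; apply: eq_bigr => i _ /=.
rewrite -/(fps_exp _ k) IHk /fps_negq mulrACA -exprD subnKC //.
by rewrite -ltnS.
Qed.

Lemma fps_exp_scale (t : A) f k N :
  fps_exp (fps_scale t f) k N = t ^+ k * fps_exp f k N.
Proof.
elim: k N => [|k IHk] N; first by rewrite /= mul1r.
rewrite /= /fps_mul big_distrr; apply: eq_bigr => i _ /=.
by rewrite -/(fps_exp _ k) IHk /fps_scale exprS mulrACA.
Qed.

(** Modulo q^(N+1) a power series is a polynomial, which gives access to the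
    ring structure, and so to the binomial formula, of polynomials. *)
Lemma fps_exp_poly f k n N : (n <= N)%N ->
  fps_exp f k n = ((\poly_(i < N.+1) f i) ^+ k)`_n.
Proof.
elim: k n => [|k IHk] n nN; first by rewrite expr0 coef1.
rewrite exprS coefM /= /fps_mul; apply: eq_bigr => i _.
rewrite -/(fps_exp f k) IHk ?(leq_trans (leq_subr _ _)) // coef_poly.
by rewrite (leq_trans (ltn_ord i)).
Qed.

Lemma fps_exp_binomial f k N :
  fps_exp f k N
  = \sum_(j < k.+1) 'C(k, j)%:R * fps_exp (fps_sub f (fps_one A)) j N.
Proof.
rewrite (fps_exp_poly _ _ (leqnn N)).
set P := \poly_(i < _) _; rewrite -(subrK 1 P) addrC exprDn coef_sum.
apply: eq_bigr => j _; rewrite expr1n mul1r coefMn mulr_natl.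
rewrite (fps_exp_poly _ _ (leqnn N)); congr (((_ : {poly A}) ^+ j)`_N *+ _).
apply/polyP => i; rewrite coefB !coef_poly coef1 /fps_sub /fps_one.
by case: i => [|i] //=; rewrite !subr0.
Qed.

Lemma fps_exp_gt f k N : f 0%N = 0 -> (N < k)%N -> fps_exp f k N = 0.
Proof.
move=> f0; elim: k N => // k IHk N Nk.
rewrite /= /fps_mul big_ord_recl f0 mul0r add0r big1 // => i _.
rewrite -/(fps_exp f k) IHk ?mulr0 // lift0 /bump /=.
by case: N Nk i => [|N] Nk [i hi] //=; rewrite subSS (leq_ltn_trans (leq_subr _ _)).
Qed.

End PowerSeries.

(** * Falling factorials *)

(** The matrix (k^_j) is triangular, with the nonzero entries k! on the
    diagonal. *)
Lemma ffact_independent (n : nat) (a : nat -> rat) :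
  (forall k, \sum_(j < n) a j * (k ^_ j)%:R = 0) -> forall j, (j < n)%N -> a j = 0.
Proof.
move=> h j; elim/ltn_ind: j => k IHk kn; have := h k.
rewrite (bigD1 (Ordinal kn)) //= ffactnn big1 ?addr0.
  by move/eqP; rewrite mulf_eq0 pnatr_eq0 -leqn0 leqNgt fact_gt0 orbF => /eqP.
move=> j jk; case: (ltngtP j k) => [ltjk|gtjk|ejk].
- by rewrite IHk ?mul0r.
- by rewrite ffact_small ?mulr0.
- by rewrite -val_eqE /= ejk eqxx in jk.
Qed.

(** * Specialization *)

(** Substitution is a ring morphism, so the cross-multiplied equality of two
    fractions representing f survives it. *)
Lemma restricts_to_unique m (f : ratfun m.+1) (g h : ratfun m) :
  restricts_to f g -> restricts_to f h -> h = g.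
Proof.
move=> [p [q [rq fpq ->]]] [p' [q' [rq' fpq' ->]]].
have nz r : restr_poly r != 0 -> tofrac r != 0 :> ratfun m.+1.
  by rewrite tofrac_eq0; apply: contra_neq => ->; rewrite /restr_poly rmorph0.
have nz' r : restr_poly r != 0 -> tofrac (restr_poly r) != 0 :> ratfun m.
  by rewrite tofrac_eq0.
move/eqP: fpq'; rewrite {}fpq eqr_div ?nz // -!tofracM tofrac_eq => /eqP e.
apply/esym/eqP; rewrite eqr_div ?nz' // -!tofracM tofrac_eq.
by have := congr1 (@restr_poly m) e; rewrite /restr_poly !rmorphM => ->.
Qed.

Lemma restriction_eq m (f : ratfun m.+1) (g : ratfun m) :
  restricts_to f g -> restriction f = g.
Proof. by move=> fg; apply: xget_unique => // h; apply: restricts_to_unique. Qed.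

Lemma prod_natr_ffact (k c : nat) :
  \prod_(i < c) ((k : int)%:~R - i%:R) = (k ^_ c)%:R :> rat.
Proof.
elim: c => [|c IHc]; first by rewrite big_ord0 ffactn0.
rewrite big_ord_recr /= IHc ffactnSr natrM.
have [ck|kc] := leqP c k; first by rewrite natrB.
by rewrite ffact_small // !mul0r.
Qed.

(** * The numbers omega *)

(** The coefficient of q^N in the hypothesis on the signs, at l = k >= 0,
    pulled back from the field of rational functions to the rationals. *)
Lemma omega_ffact_sum m (w : npart m.+1 -> ratfun m.+1)
    (omega : npart m.+1 -> rat) : good_signs w -> is_omega w omega ->
  forall k N,
    pseries [set: npart m.+1] (fun pi => omega pi * (k ^_ corner pi)%:R) N
    = fps_exp (Mser rat m) k N.
Proof.
move=> hgood [homega0 homega] k [|N].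
  (* Only the empty partition has size 0; there omega is 1 by convention and
     not through w, whose sign at the empty partition is arbitrary. *)
  rewrite pseriesE -fsbig_finite ?psize_eq0 ?fsbig_set1; last exact: finite_set1.
  rewrite homega0; last first.
    by have : [set empty_npart m.+1] (empty_npart m.+1) by []; rewrite -psize_eq0.
  rewrite /= ffactn0 mulr1; elim: k => [|k IHk]; first by [].
  by rewrite /= /fps_mul big_ord_recl big_ord0 Mser0 mul1r addr0.
have [f fE] : exists f : {rmorphism rat -> ratfun m}, const m =1 f.
  by exists (@tofrac _ \o @mpolyC m rat).
apply: (fmorph_inj f); rewrite -fps_exp_rmorph -Mser_rmorph.
have [_ /(_ N.+1)] := hgood k; rewrite /= /fps_add /fps_one add0r.
rewrite fps_exp_negq => hN; rewrite -[RHS](signrMK N.+1) -{}hN.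
rewrite pseriesE -fsbig_finite; last exact: finite_psize.
rewrite /pseries.
have -> : [set pi : npart m.+1 | psize pi = N.+1 /\ (1 <= psize pi)%N]
    = [set pi | psize pi = N.+1].
  by apply/seteqP; split=> pi /=; [case | move=> ->].
rewrite !fsbig_finite; try exact: finite_psize.
rewrite big_distrr rmorph_sum big_seq [RHS]big_seq.
apply: eq_bigr => pi; rewrite in_fset_set ?inE; last exact: finite_psize.
move=> /= piN.
rewrite (restriction_eq (homega pi _ k)) ?piN // prod_natr_ffact.
rewrite fE -mulrA [in RHS]rmorphM rmorphXn rmorphN1.
by rewrite /= signrMK.
Qed.

Definition corner_sum m (omega : npart m.+1 -> rat) (N j : nat) : rat :=
  \sum_(pi <- finmap.enum_fset (fset_set [set pi : npart m.+1 | psize pi = N])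
         | corner pi == j) omega pi.

Lemma pseries_corner m (A : comUnitRingType) (f : {rmorphism rat -> A})
    (omega : npart m.+1 -> rat) (b : nat -> A) N :
  pseries [set: npart m.+1] (fun pi => f (omega pi) * b (corner pi)) N
  = \sum_(j < N.+1) f (corner_sum omega N j) * b j.
Proof.
rewrite pseriesE /corner_sum.
under [RHS]eq_bigr do rewrite rmorph_sum big_distrl /=.
rewrite (exchange_big_dep xpredT) //= big_seq [RHS]big_seq.
apply: eq_bigr => pi; rewrite in_fset_set ?inE; last exact: finite_psize.
move=> /= piN; have cN : (corner pi < N.+1)%N by rewrite ltnS -piN leq_psize.
by rewrite (big_pred1 (Ordinal cN)).
Qed.

(** Both sides, as sequences in j, have the same sums against the falling
    factorials k^_j for every k, hence agree. *)
Lemma corner_sumE m (w : npart m.+1 -> ratfun m.+1)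
    (omega : npart m.+1 -> rat) : good_signs w -> is_omega w omega ->
  forall N j, (j < N.+1)%N ->
    corner_sum omega N j
    = (j`!%:R)^-1 * fps_exp (fps_sub (Mser rat m) (fps_one rat)) j N.
Proof.
move=> hgood homega N j jN; apply/eqP; rewrite -subr_eq0; apply/eqP.
move: j jN; apply: ffact_independent => k.
set g := fps_sub _ _.
have g0 : g 0%N = 0 by rewrite /g /fps_sub Mser0 subrr.
under eq_bigr do rewrite mulrBl; rewrite sumrB; apply/eqP; rewrite subr_eq0.
have := omega_ffact_sum hgood homega k N.
rewrite (pseries_corner (idfun : {rmorphism rat -> rat}) omega (fun j => (k ^_ j)%:R)).
move=> /= ->; rewrite fps_exp_binomial -/g.
pose F j := 'C(k, j)%:R * fps_exp g j N.
have widen p : (p <= k + N)%N -> (forall j, (p < j)%N -> F j = 0) ->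
    \sum_(j < p.+1) F j = \sum_(j < (k + N).+1) F j.
  move=> pM F0; rewrite (big_ord_widen (k + N).+1) // big_mkcond.
  apply: eq_bigr => i _; case: ifP => //; rewrite ltnS => /negbT.
  by rewrite -ltnNge => /F0.
(* The binomial sum runs to k and the sum over corner entries to N.  Both are
   extended to k + N: the binomial vanishes for j > k, and g^j has no
   coefficient at q^N for j > N. *)
rewrite (widen k (leq_addr _ _)); last first.
  by move=> j kj; rewrite /F bin_small ?mul0r.
rewrite -(widen N (leq_addl _ _)); last first.
  by move=> j Nj; rewrite /F fps_exp_gt ?mulr0.
apply/eqP; apply: eq_bigr => j _; rewrite /F -bin_ffact natrM.
rewrite [RHS]mulrC -mulrA mulVKr //.
by rewrite unitfE pnatr_eq0 -lt0n fact_gt0.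
Qed.

(** Over any algebra over the rationals, so that t may be the formal variable
    as well as the number 1. *)
Lemma omega_series m (w : npart m.+1 -> ratfun m.+1)
    (omega : npart m.+1 -> rat) (A : comUnitRingType)
    (f : {rmorphism rat -> A}) (t : A) : good_signs w -> is_omega w omega ->
  pseries [set: npart m.+1] (fun pi => f (omega pi) * t ^+ corner pi)
    =1 fps_expe (fps_scale t (fps_sub (Mser A m) (fps_one A))).
Proof.
move=> hgood homega N; rewrite (pseries_corner f omega (fun j => t ^+ j)).
apply: eq_bigr => j _; rewrite (corner_sumE hgood homega) //.
rewrite fps_exp_scale (Mser_rmorph f).
have -> : fps_sub (f \o Mser rat m) (fps_one A)
    = f \o fps_sub (Mser rat m) (fps_one rat).
  by apply/funext => n; rewrite /= /fps_sub rmorphB /fps_one rmorph_nat.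
rewrite fps_exp_rmorph rmorphM rmorphV ?rmorph_nat; last first.
  by rewrite unitfE pnatr_eq0 -lt0n fact_gt0.
by rewrite mulrAC mulrA.
Qed.

Theorem theorem1p8 (m : nat) (hd : (4 <= m.+2)%N) (hd4 : m.+2 = 0 %[mod 4])
    (hadm : ext0_admissible m) (hconj : conjecture m)
    (w : npart m.+1 -> ratfun m.+1) (hw : is_w w) (hgood : good_signs w)
    (omega : npart m.+1 -> rat) (homega : is_omega w omega) :
  pseries [set: npart m.+1] (fun pi => omega pi *: 'X^(corner pi) : {poly rat})
    =1 fps_expe (fps_scale 'X (fps_sub (Mser {poly rat} m) (fps_one {poly rat})))
  /\
  pseries [set: npart m.+1] omega
    =1 fps_expe (fps_sub (Mser rat m) (fps_one rat)).
Proof.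
split.
  move=> N; rewrite -(omega_series (@polyC rat) 'X hgood homega).
  by congr (pseries _ _ _); apply/funext => pi; rewrite -mul_polyC.
move=> N.
have -> : fps_sub (Mser rat m) (fps_one rat)
    = fps_scale 1 (fps_sub (Mser rat m) (fps_one rat)).
  by apply/funext => n; rewrite /fps_scale mul1r.
rewrite -(omega_series (idfun : {rmorphism rat -> rat}) 1 hgood homega).
by congr (pseries _ _ _); apply/funext => pi; rewrite /= expr1n mulr1.
Qed.
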